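(* Let $\phi$ be an arbitrarily slowly growing function, i.e. any positive function of $n$ with $\phi(n)\to\infty$ as $n\to\infty$, such that $\phi(n) < n/\log_2 n$. Then there is a function $\delta(n)$ with $\delta(n) = o(1)$ as $n\to\infty$ such that for all sufficiently large $n$ $$D(n,0) \;\leq\; \frac{n2^{n+5}}{\log_2 n - \log_2\log_2 n - \log_2\phi(n)}\,\bigl(1+\epsilon(n)\bigr),$$ where $$\epsilon(n) = \frac{1}{4\phi(n)} + \left(4 - \delta(n)\right)\frac{\log_2 n\cdot \log_2\log_2 n}{n}.$$
   Context: For $n\ge 1$, $j\in\{1,\dots,n\}$ and $I \subseteq \{1,\dots,n\}\setminus\{j\}$, the gate $TOF(I;j)$ on $n$ inputs defines the transformation $\mathbb{Z}_2^n \to \mathbb{Z}_2^n$ that replaces $x_j$ by $x_j \oplus \bigwedge_{i\in I} x_i$ and leaves all other coordinates unchanged; for $I=\emptyset$ it is the NOT gate $x_j \mapsto x_j\oplus 1$. Let $\Omega_n^2$ be the set of all gates $TOF(I;j)$ on $n$ inputs with $|I|\le 2$ (NOT, CNOT and 2-CNOT gates). A reversible circuit $\mathfrak{S}$ with $n$ inputs is a finite sequence (composition) of $l\ge 0$ gates from $\Omega_n^2$, applied one after another; it defines a transformation $g:\mathbb{Z}_2^n\to\mathbb{Z}_2^n$. A (nonempty) circuit has depth $1$ if for any two distinct gates $TOF(I_1;t_1)$, $TOF(I_2;t_2)$ occurring in it (distinct positions), $(\{t_1\}\cup I_1)\cap(\{t_2\}\cup I_2)=\emptyset$. The depth $D(\mathfrak{S})$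 is the minimal $d$ such that the sequence $\mathfrak{S}$ can be divided into $d$ disjoint consecutive sub-circuits each of depth $1$. A reversible circuit with $n$ inputs defining $g$ implements $f:\mathbb{Z}_2^n\to\mathbb{Z}_2^n$ without additional inputs if there is a permutation $\pi$ of $\{1,\dots,n\}$ such that for every $x\in\mathbb{Z}_2^n$, writing $g(x) = (y_1,\dots,y_n)$, one has $f(x) = (y_{\pi(1)},\dots,y_{\pi(n)})$. $F(n,0)$ is the set of all transformations $\mathbb{Z}_2^n\to\mathbb{Z}_2^n$ that can be implemented in this way by reversible circuits with $n$ inputs (gates from $\Omega_n^2$). For $f\in F(n,0)$, $D(f,0)$ is the minimum of $D(\mathfrak{S})$ over all circuits $\mathfrak{S}$ of gates from $\Omega_n^2$ implementing $f$ without additional inputs, and $D(n,0) = \max_{f\in F(n,0)} D(f,0)$. *)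

(* Defs.v *)
From HB Require Import structures.
From mathcomp Require Import all_boot all_order all_algebra all_fingroup.
From mathcomp Require Import all_classical all_reals all_analysis.
Set Implicit Arguments.
Unset Strict Implicit.
Unset Printing Implicit Defensive.
Import Order.TTheory GRing.Theory Num.Theory.
Import numFieldNormedType.Exports.

Local Open Scope classical_set_scope.

(* The default value 0 is returned only when P is empty, see [minimumP]. *)
Definition minimum (P : set nat) : nat :=
  xget 0 [set d | P d /\ forall e, P e -> d <= e].

Lemma minimumP (P : set nat) : P !=set0 ->
  P (minimum P) /\ forall e, P e -> minimum P <= e.
Proof.
move=> [m Pm]; suff ex_min : exists d, P d /\ forall e, P e -> d <= e.
  exact: (xgetPex 0 ex_min).
have exP : exists d, `[< P d >] by exists m; apply/asboolP.
case: (ex_minnP exP) => d /asboolP Pd dmin.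
by exists d; split=> // e Pe; apply: dmin; apply/asboolP.
Qed.

(* Z_2^n, with addition [addb] and multiplication [andb] on coordinates. *)
Definition bitvec (n : nat) := {ffun 'I_n -> bool}.

Definition transformation (n : nat) := {ffun bitvec n -> bitvec n}.

Record gate (n : nat) := TOF {
  controls : {set 'I_n};
  target : 'I_n;
  target_notin_controls : target \notin controls }.

Definition gate_map n (t : gate n) (x : bitvec n) : bitvec n :=
  [ffun k => if k == target t
             then x k (+) [forall i in controls t, x i] else x k].

Definition Omega2 n (t : gate n) : bool := #|controls t| <= 2.

Definition circuit (n : nat) := seq (gate n).

(* The head of the sequence is the gate applied first. *)
Definition circuit_map n (S : circuit n) : transformation n :=
  [ffun x => foldl (fun y t => gate_map t y) x S].

Definition lines n (t : gate n) : {set 'I_n} := target t |: controls t.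

Definition depth_one n (S : circuit n) : bool :=
  (0 < size S) &&
  pairwise (fun t1 t2 : gate n => lines t1 :&: lines t2 == finset.set0) S.

Definition divisible_into n (S : circuit n) (d : nat) : Prop :=
  exists ss : seq (circuit n),
    [/\ flatten ss = S, size ss = d & all (@depth_one n) ss].

Definition depth n (S : circuit n) : nat := minimum [set d | divisible_into S d].

Lemma divisible_into_size n (S : circuit n) : divisible_into S (size S).
Proof.
exists [seq [:: t] | t <- S]; split; last 1 first.
- by elim: S.
- exact: flatten_seq1.
- exact: size_map.
Qed.

Definition implements n (S : circuit n) (f : transformation n) : Prop :=
  exists pi : 'S_n,
    forall x : bitvec n, f x = [ffun i => circuit_map S x (pi i)].

Definition F0 (n : nat) : set (transformation n) :=
  [set f | exists S : circuit n, all (@Omega2 n) S /\ implements S f].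

Lemma F0_id n : F0 [ffun x : bitvec n => x].
Proof.
exists [::]; split=> //; exists 1%g => x.
by apply/ffunP => i; rewrite !ffunE perm1.
Qed.

Definition D0_of n (f : transformation n) : nat :=
  minimum [set d | exists S : circuit n,
                     [/\ all (@Omega2 n) S, implements S f & depth S = d]].

(* The index set is nonempty by [F0_id]. *)
Definition D0 (n : nat) : nat :=
  \max_(f : transformation n | `[< F0 f >]) D0_of f.

Definition log2 (R : realType) (x : R) : R := (ln x / ln 2)%R.

(* Main.v *)
Require Import Defs.
From mathcomp Require Import all_boot all_order all_algebra all_fingroup.
From mathcomp Require Import all_classical all_reals all_analysis.
From mathcomp Require Import zify.
Set Implicit Arguments.
Unset Strict Implicit.
Unset Printing Implicit Defensive.
Import Order.TTheory GRing.Theory Num.Theory.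
Import numFieldNormedType.Exports.

(* Depth, unlike size, leaves a lot of room: every 3-cycle of Z_2^n has a circuit of
   depth O(sqrt n) = o(n / log n), and the transformation of a circuit on n >= 4 lines
   is an even permutation of Z_2^n, hence a product of at most 2^n 3-cycles.
   This gives the bound already with delta = 0, since the denominator is
   at most log2 n.

   XOR-ing a constant has depth 1 and fanning out a line has depth O(log n); conjugating
   by such maps sends any three points to 1..1, 1..1 + e_i, 1..1 + e_j.  The
   3-cycle on these is the commutator of x_i ^= x_j AND(A) and x_j ^= x_i AND(B),
   where {i, j}, A, B partition the lines, as the supports of these two
   involutions share a single point.  Each of these two gates leaves about n/2 idle
   lines, which serve as dirty workspace.  To compute t ^= AND(C) AND(A) with
   |C| about sqrt n, the controls in A are cut into |C| blocks of about sqrt n lines,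
   whose conjunctions are computed in parallel onto the lines of C; these can play
   the role of clean ancillas because only the case where they all
   carry 1 matters. *)

(** * Permutations realizable within a given depth *)

Section Realizable.
Local Open Scope group_scope.
Variable n : nat.
Implicit Types (x y : bitvec n) (t k : 'I_n) (A X Y : seq 'I_n) (g h : gate n).
Implicit Types (s p q : {perm bitvec n}) (d e : nat).

Lemma gate_mapK g : involutive (gate_map g).
Proof.
move=> x; apply/ffunP => k; rewrite !ffunE; case: eqP => // ->.
have -> : [forall i in controls g, gate_map g x i] = [forall i in controls g, x i].
  apply: eq_forallb_in => i iC; rewrite ffunE; case: eqP => // ei.
  by move: (target_notin_controls g); rewrite -ei iC.
by rewrite -addbA addbb addbF.
Qed.

Definition gate_perm g : {perm bitvec n} := perm (can_inj (gate_mapK g)).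

Definition circuit_perm (S : circuit n) : {perm bitvec n} :=
  \prod_(g <- S) gate_perm g.

Lemma circuit_perm_cat (S S' : circuit n) :
  circuit_perm (S ++ S') = circuit_perm S * circuit_perm S'.
Proof. exact: big_cat. Qed.

Lemma circuit_permE (S : circuit n) x : circuit_map S x = circuit_perm S x.
Proof.
rewrite ffunE /circuit_perm; elim: S x => [|g S IH] x /=.
  by rewrite big_nil perm1.
by rewrite big_cons permM IH permE.
Qed.

Lemma gate_perm_sq g : gate_perm g * gate_perm g = 1.
Proof. by apply/permP => x; rewrite permM !permE gate_mapK. Qed.

Lemma commute_gate_perm g h :
  lines g :&: lines h == finset.set0 -> commute (gate_perm g) (gate_perm h).
Proof.
move=> /eqP gh0; have gh k : k \in lines g -> k \in lines h -> False.
  by move=> kg kh; move/setP/(_ k): gh0; rewrite finset.in_setI kg kh finset.in_set0.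
have tg k : k \in controls g -> k \in lines g by rewrite !inE orbC => ->.
have th k : k \in controls h -> k \in lines h by rewrite !inE orbC => ->.
have ttg : target g \in lines g by rewrite !inE eqxx.
have tth : target h \in lines h by rewrite !inE eqxx.
have Eg x : [forall i in controls g, gate_map h x i] = [forall i in controls g, x i].
  apply: eq_forallb_in => i iC; rewrite ffunE; case: eqP => // ei.
  by case: (gh i); rewrite ?tg // ei.
have Eh x : [forall i in controls h, gate_map g x i] = [forall i in controls h, x i].
  apply: eq_forallb_in => i iC; rewrite ffunE; case: eqP => // ei.
  by case: (gh i); rewrite ?th // ei.
apply/permP => x; rewrite !permM !permE; apply/ffunP => k.
rewrite /gate_map !ffunE -!/(gate_map _ _) Eg Eh.
case: (eqVneq k (target g)) => // ->; case: eqP => // e.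
by case: (gh (target h)) => //; rewrite -e.
Qed.

(** Unlike in [depth_one], the list may be empty, and every gate is confined to the lines [X]. The
    confinement is what later lets two circuits run side by side. *)
Definition layer X (l : circuit n) : bool :=
  [&& all (@Omega2 n) l, all (fun g => lines g \subset X) l
    & pairwise (fun g h => lines g :&: lines h == finset.set0) l].

(** The index only bounds the number of layers, since [realizable1] holds at every index; circuits
    of different depths can then be combined without padding. *)
Inductive realizable X : nat -> {perm bitvec n} -> Prop :=
| realizable1 d : realizable X d 1
| realizable_layer d l s : layer X l -> realizable X d s ->
    realizable X d.+1 (circuit_perm l * s).

Lemma realizable_mono X Y d e s :
  {subset X <= Y} -> d <= e -> realizable X d s -> realizable Y e s.
Proof.
move=> XY de rs; elim: rs e de => {d s} [d e _|d l s /and3P[lO lX lp] _ IH [//|e] de].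
  exact: realizable1.
apply: realizable_layer; last exact: IH.
rewrite /layer lO lp andbT /=; apply: sub_all lX => g /fintype.subsetP gX.
by apply/fintype.subsetP => k /gX /XY.
Qed.

Lemma realizable_le X d e s :
  d <= e -> realizable X d s -> realizable X e s.
Proof. exact: realizable_mono. Qed.

Lemma realizable_mul X d e s p :
  realizable X d s -> realizable X e p -> realizable X (d + e) (s * p).
Proof.
elim=> {d s} [d|d l s lX _ IH] rp.
  by rewrite mul1g; apply: realizable_mono rp => //; apply: leq_addl.
by rewrite -mulgA addSn; apply: realizable_layer => //; apply: IH.
Qed.

Lemma commute_circuit_perm g (l : circuit n) :
  all (fun h => lines g :&: lines h == finset.set0) l ->
  commute (gate_perm g) (circuit_perm l).
Proof.
rewrite /circuit_perm; elim: l => [_|h l IH] /=.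
  by rewrite big_nil; apply: commute1.
case/andP => gh gl; rewrite big_cons; apply: commuteM; last exact: IH.
exact: commute_gate_perm.
Qed.

(** Gates are involutions and those of one layer commute, so each layer is its own inverse and
    reversing the order of the layers suffices. *)
Lemma realizable_inv X d s : realizable X d s -> realizable X d s^-1.
Proof.
elim=> {d s} [d|d l s lX _ IH]; first by rewrite invg1; apply: realizable1.
have -> : (circuit_perm l * s)^-1 = s^-1 * (circuit_perm l * 1).
  rewrite mulg1 invMg; congr (_ * _); case/and3P: lX => _ _.
  rewrite /circuit_perm; elim: l => [|g l IHl]; first by rewrite big_nil invg1.
  rewrite big_cons pairwise_cons => /andP[gl lp]; rewrite invMg IHl //.
  rewrite [RHS](commute_circuit_perm gl); congr (_ * _).
  by apply: (mulgI (gate_perm g)); rewrite gate_perm_sq mulgV.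
rewrite -addn1; apply: realizable_mul => //; apply: realizable_layer => //.
exact: realizable1.
Qed.

Lemma layers_disjoint X Y (l m : circuit n) : [disjoint X & Y] ->
  layer X l -> layer Y m ->
  all (fun g => all (fun h => lines g :&: lines h == finset.set0) m) l.
Proof.
move=> XY /and3P[_ lX _] /and3P[_ mY _]; apply: sub_all lX => g gX.
apply: sub_all mY => h hY; rewrite setI_eq0.
exact: disjointWl gX (disjointWr hY XY).
Qed.

Lemma commute_layers X Y (l m : circuit n) : [disjoint X & Y] ->
  layer X l -> layer Y m -> commute (circuit_perm l) (circuit_perm m).
Proof.
move=> XY lX mY; have := layers_disjoint XY lX mY => {lX}.
elim: l => [_|g l IH] /=.
  by rewrite /circuit_perm big_nil; apply/commute_sym/commute1.
case/andP => gm lm; rewrite /circuit_perm big_cons -/(circuit_perm l).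
apply/commute_sym/commuteM; apply/commute_sym; last exact: IH.
exact: commute_circuit_perm.
Qed.

Lemma realizable_commute X Y d e s p : [disjoint X & Y] ->
  realizable X d s -> realizable Y e p -> commute s p.
Proof.
move=> XY rs rp; elim: rs => {d s} [d|d l s lX _ IH].
  exact/commute_sym/commute1.
apply/commute_sym/commuteM; apply/commute_sym => // {IH}.
elim: rp => {e p} [e|e m p mY _ IH]; first exact: commute1.
apply: commuteM => //; exact: commute_layers XY lX mY.
Qed.

(** The two circuits are merged layer by layer: what remains of [s] commutes past the first layer of
    [p], as they act on disjoint lines. *)
Lemma realizable_par X Y d s p : [disjoint X & Y] ->
  realizable X d s -> realizable Y d p -> realizable (X ++ Y) d (s * p).
Proof.
have subl : {subset X <= X ++ Y} by move=> k kX; rewrite mem_cat kX.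
have subr : {subset Y <= X ++ Y} by move=> k kY; rewrite mem_cat kY orbT.
move=> XY rs; elim: rs p => {d s} [d p rp|d l s lX rs IH p rp].
  by rewrite mul1g; apply: realizable_mono rp.
move ed : d.+1 rp => d' rp.
case: rp ed => {d' p} [d' ed|d' m p mY rp [ed]]; subst d'.
  rewrite mulg1; apply: realizable_mono subl (leqnn _) _.
  exact: realizable_layer.
have rm : realizable Y 1 (circuit_perm m).
  by rewrite -[circuit_perm m]mulg1; apply: realizable_layer => //; apply: realizable1.
have -> : circuit_perm l * s * (circuit_perm m * p)
    = circuit_perm (l ++ m) * (s * p).
  rewrite circuit_perm_cat -!mulgA.
  by congr (_ * _); rewrite !mulgA (realizable_commute XY rs rm).
apply: realizable_layer; last exact: IH.
have lm := layers_disjoint XY lX mY.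
case/and3P: lX => lO lX lp; case/and3P: mY => mO mY mp.
rewrite /layer !all_cat lO mO pairwise_cat lp mp /= !andbT -andbA; apply/and3P; split.
- by apply: sub_all lX => g /fintype.subsetP gX; apply/fintype.subsetP => k /gX /subl.
- by apply: sub_all mY => g /fintype.subsetP gX; apply/fintype.subsetP => k /gX /subr.
- by [].
Qed.

Lemma tof_gate_subproof A t : t \notin [set i in A | i != t].
Proof. by rewrite !inE eqxx andbF. Qed.

(* If [t] occurs in [A], it is dropped from the controls. *)
Definition tof A t : {perm bitvec n} := gate_perm (TOF (tof_gate_subproof A t)).

Lemma tofE A t x k : t \notin A ->
  tof A t x k = if k == t then x k (+) all x A else x k.
Proof.
move=> tA; rewrite permE ffunE /=; case: eqP => // _; congr (_ (+) _).
apply/forall_inP/allP => Ax i iA; apply: Ax; move: iA; rewrite !inE.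
  by move=> iA; rewrite iA; apply: contraNneq tA => <-.
by case/andP.
Qed.

Lemma tof_sq A t : tof A t * tof A t = 1.
Proof. exact: gate_perm_sq. Qed.

Lemma realizable_tof A t : size A <= 2 -> realizable (t :: A) 1 (tof A t).
Proof.
move=> sA; have -> : tof A t = circuit_perm [:: TOF (tof_gate_subproof A t)] * 1.
  by rewrite /circuit_perm big_seq1 mulg1.
apply: realizable_layer; last exact: realizable1.
rewrite /layer /= !andbT; apply/andP; split.
  apply: leq_trans sA; apply: leq_trans (card_size A).
  by apply/subset_leq_card/fintype.subsetP => i; rewrite !inE => /andP[].
by apply/fintype.subsetP => i; rewrite !inE => /orP[->//|/andP[->]]; rewrite orbT.
Qed.

(** Empty layers are dropped here, because [depth_one] excludes them; this and the slack in [d]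
    leave only an inequality [e <= d]. *)
Lemma realizable_circuit d s : realizable (enum 'I_n) d s ->
  exists S : circuit n, exists2 e, e <= d &
    [/\ all (@Omega2 n) S, circuit_perm S = s & divisible_into S e].
Proof.
elim=> {d s} [d|d l s /and3P[lO _ lp] _ [S [e ed [SO <- [ss [fl se sl]]]]]].
  exists [::]; exists 0 => //; split => //; first by rewrite /circuit_perm big_nil.
  by exists [::].
exists (l ++ S); case: (posnP (size l)) => [/size0nil l0|l_gt0].
  exists e; first exact: leqW.
  split; rewrite ?l0 //; first by rewrite /circuit_perm big_nil mul1g.
  by exists ss.
exists e.+1 => //; split; first by rewrite all_cat lO.
  exact: circuit_perm_cat.
by exists (l :: ss); split => /=; rewrite ?fl ?se // sl andbT /depth_one l_gt0.
Qed.
End Realizable.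

(** * Multiply controlled gates *)

Section Synthesis.
Local Open Scope group_scope.
Variable n : nat.
Implicit Types (x y : bitvec n) (i j t a k : 'I_n) (A B C X Y : seq 'I_n).
Implicit Types (s p q r m : {perm bitvec n}).

Lemma uniq_cat_disjoint X Y : uniq (X ++ Y) -> [disjoint X & Y].
Proof. by rewrite cat_uniq disjoint_sym disjoint_has => /and3P[]. Qed.

Lemma eq_all_off x y A t : (forall k, k != t -> x k = y k) -> t \notin A ->
  all x A = all y A.
Proof.
move=> xy tA; apply: eq_in_all => k kA; apply: xy.
by apply: contraNneq tA => <-.
Qed.

(* The line [a] is dirty: its unknown value cancels between the two uses
   of [r]. *)
Lemma toggle t a (f h : bitvec n -> bool) r m : t != a ->
  (forall x k, r x k = if k == t then x k (+) (x a && f x) else x k) ->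
  (forall x k, m x k = if k == a then x k (+) h x else x k) ->
  (forall x y, (forall k, k != t -> k != a -> x k = y k) ->
    f x = f y /\ h x = h y) ->
  forall x k,
    (r * m * r * m) x k = if k == t then x k (+) (h x && f x) else x k.
Proof.
move=> ta Er Em fh x k; rewrite !permM.
have [fr hr] : (f (r x) = f x) /\ (h (r x) = h x).
  by apply: fh => l lt la; rewrite Er (negbTE lt).
have [fm hm] : (f (m (r x)) = f x) /\ (h (m (r x)) = h x).
  by rewrite -fr -hr; apply: fh => l lt la; rewrite Em (negbTE la).
have [_ h3] : (f (r (m (r x))) = f x) /\ (h (r (m (r x))) = h x).
  by rewrite -fm -hm; apply: fh => l lt la; rewrite Er (negbTE lt).
have at_ : (a == t) = false by rewrite eq_sym (negbTE ta).
have ma : m (r x) a = x a (+) h x by rewrite Em eqxx Er at_ hr.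
case: (eqVneq k t) => [->|kt].
  rewrite Em (negbTE ta) Er eqxx Em (negbTE ta) Er eqxx ma fm.
  by case: (x t); case: (x a); case: (f x); case: (h x).
case: (eqVneq k a) => [->|ka].
  by rewrite Em eqxx Er at_ ma h3 -addbA addbb addbF.
by rewrite Em (negbTE ka) Er (negbTE kt) Em (negbTE ka) Er (negbTE kt).
Qed.

(** The case of [toggle] where both factors are gates. Each factor occurs twice in the product,
    which also yields the parity in [gate_perm_even]. *)
Lemma tof_toggle t a (X A : seq 'I_n) : uniq [:: t; a] ->
  t \notin X ++ A -> a \notin X ++ A ->
  tof (a :: X) t * tof A a * tof (a :: X) t * tof A a = tof (X ++ A) t.
Proof.
rewrite /= inE andbT => ta tXA aXA; have := tXA; have := aXA.
rewrite !mem_cat !negb_or => /andP[aX aA] /andP[tX tA].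
apply/permP => x; apply/ffunP => k.
have tofX y l : tof (a :: X) t y l = if l == t then y l (+) (y a && all y X) else y l.
  by rewrite tofE // inE negb_or ta.
have tofA y l : tof A a y l = if l == a then y l (+) all y A else y l.
  by rewrite tofE.
rewrite (toggle ta tofX tofA); first by rewrite tofE // all_cat andbC.
move=> y z yz; split; apply: eq_in_all => l lX; apply: yz;
  by [apply: contraNneq tX => <- | apply: contraNneq aX => <-
     |apply: contraNneq tA => <- | apply: contraNneq aA => <-].
Qed.

(** [p] is the garbage that half a ladder leaves on [A ++ B]. With R = [tof [:: b; a] t] and M =
    [tof A b], [tof_toggle] gives [tof (a :: A) t] = R M R M. The garbage [q] of the smaller ladder
    avoids the lines of R, so R (M q) R = (R M R M) (M q), and the new garbage is M q. Leaving its
    removal to [ladder] makes the depth grow by 2 per control instead of doubling. *)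
Lemma ladder_step t A B : uniq (t :: A ++ B) -> size A <= size B ->
  exists2 p, realizable (A ++ B) (2 * size A) p &
    realizable (t :: A ++ B) (2 * size A).+1 (tof A t * p).
Proof.
elim: A t B => [|a A IH] t [|b B] //= U sAB.
- by exists 1; [apply: realizable1|rewrite mulg1; apply: realizable_tof].
- exists 1; first exact: realizable1.
  rewrite mulg1; apply: realizable_mono (@realizable_tof _ [::] t _) => //.
  by move=> k; rewrite !inE => ->.
have P : perm_eq ([:: t; b; a] ++ (A ++ B)) (t :: a :: A ++ b :: B).
  by apply/seq.permP => q; rewrite /= !count_cat /=; lia.
have {}U : uniq ([:: t; b; a] ++ (A ++ B)) by rewrite (perm_uniq P).
have tbaAB := uniq_cat_disjoint U.
have [|//|q rq rMq] := IH b B.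
  by move: U; rewrite /= !inE !negb_or => /and4P[_ /andP[_ ->] _ ->].
exists (tof A b * q).
  apply: realizable_mono rMq; last by lia.
  by move=> k; rewrite !(inE, mem_cat) orbCA => ->; rewrite orbT.
have rR : realizable [:: t; b; a] 1 (tof [:: b; a] t) by apply: realizable_tof.
have RM : tof [:: b; a] t * tof A b * tof [:: b; a] t * tof A b = tof (a :: A) t.
  move: U; rewrite /= !(inE, mem_cat) !negb_or.
  case/and4P=> /and4P[tb ta tA _] /and3P[ba bA _] aA U.
  by apply: tof_toggle; rewrite /= !inE ?negb_or ?tb ?ta ?ba.
have -> : tof (a :: A) t * (tof A b * q) =
    tof [:: b; a] t * (tof A b * q) * tof [:: b; a] t.
  rewrite -RM -!mulgA; do 2!congr (_ * _).
  rewrite [tof A b * (tof A b * q)]mulgA tof_sq mul1g.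
  exact: realizable_commute tbaAB rR rq.
have sub X : {subset X <= [:: t; b; a] ++ (A ++ B)} ->
    {subset X <= t :: a :: A ++ b :: B}.
  by move=> XP k /XP; rewrite (perm_mem P).
apply: (@realizable_le _ _ (1 + (2 * size A).+1 + 1)); first by lia.
apply: realizable_mul; first apply: realizable_mul.
- by apply: realizable_mono rR => //; apply: sub => k; rewrite mem_cat => ->.
- apply: realizable_mono rMq => //; apply: sub => k; rewrite !inE !mem_cat.
  by case/or3P=> ->; rewrite ?orbT.
- by apply: realizable_mono rR => //; apply: sub => k; rewrite mem_cat => ->.
Qed.

Lemma ladder t A B : uniq (t :: A ++ B) -> size A <= size B ->
  realizable (t :: A ++ B) (4 * size A + 1) (tof A t).
Proof.
move=> U sAB; have [p rp rtp] := ladder_step U sAB.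
rewrite -[tof A t](mulgK p); 
apply: (@realizable_le _ _ ((2 * size A).+1 + 2 * size A)); first by lia.
apply: realizable_mul => //; apply: realizable_inv; apply: realizable_mono rp => //.
by move=> k kAB; rewrite inE kAB orbT.
Qed.

(* The lines in [B] are dirty workspace for the parallel ladders. *)
Lemma blocks (c : nat) C A B : uniq (C ++ A ++ B) -> size A <= size B ->
  size A <= c * size C ->
  exists v (S : 'I_n -> seq 'I_n),
    [/\ realizable (C ++ A ++ B) (4 * c + 1) v,
        forall i, {subset S i <= A},
        forall x, all (fun i => all x (S i)) C = all x A &
        forall x k, v x k = if k \in C then x k (+) all x (S k) else x k].
Proof.
elim: C A B => [|i C IH] A B U sAB sAC.
  have -> : A = [::] by apply: size0nil; move: sAC => /=; lia.
  by exists 1, (fun=> [::]); split=> // *; [apply: realizable1|rewrite perm1].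
rewrite -(cat_take_drop c A) -(cat_take_drop c B) in U *.
have := size_drop c A; have := size_drop c B.
have := size_take c A; have := size_take c B.
set A1 := take c A in U *; set A2 := drop c A in U *.
set B1 := take c B in U *; set B2 := drop c B in U * => sB1 sA1 sB2 sA2.
have P : perm_eq ((i :: A1 ++ B1) ++ (C ++ A2 ++ B2))
    ((i :: C) ++ (A1 ++ A2) ++ (B1 ++ B2)).
  by apply/seq.permP => q; rewrite /= !count_cat; lia.
have {}U : uniq ((i :: A1 ++ B1) ++ (C ++ A2 ++ B2)) by rewrite (perm_uniq P).
have dis := uniq_cat_disjoint U.
have [||| v [S [rv SA allS vE]]] := IH A2 B2.
- by move: U; rewrite cat_uniq => /and3P[].
- by rewrite sA2 sB2 leq_sub2r.
- by rewrite sA2 leq_subLR -mulnS.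
have U1 : uniq (i :: A1 ++ B1) by move: U; rewrite cat_uniq => /and3P[].
have iA1 : i \notin A1 by move: U1; rewrite /= mem_cat negb_or => /andP[/andP[]].
have [iC iA2] : i \notin C /\ i \notin A2.
  by move: U; rewrite /= !mem_cat !negb_or => /andP[/and4P[_ -> -> _] _].
exists (tof A1 i * v), (fun k => if k == i then A1 else S k); split.
- apply: (@realizable_mono _ ((i :: A1 ++ B1) ++ (C ++ A2 ++ B2)) _ (4 * c + 1)) => //.
    by move=> k; rewrite (perm_mem P).
  have sA1c : size A1 <= c by rewrite sA1; case: ltnP.
  apply: realizable_par => //; apply: realizable_mono (ladder U1 _) => //; first lia.
  rewrite sB1; case: ltnP => // sBc; rewrite sA1; case: ltnP => // cA.
  exact: leq_trans (ltnW cA) sAB.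
- move=> k l; rewrite mem_cat; case: eqP => _; first by move->.
  by move/SA->; rewrite orbT.
- move=> x; rewrite /= eqxx all_cat -allS; congr (_ && _).
  by apply: eq_in_all => k kC; case: eqP => // e; rewrite -e kC in iC.
move=> x k; rewrite permM vE !tofE // inE.
have -> : all (tof A1 i x) (S k) = all x (S k).
  apply: eq_all_off (_ : i \notin _); last by apply: contra iA2 => /SA.
  by move=> l /negbTE li; rewrite tofE // li.
by case: (eqVneq k i) => [->|//]; rewrite (negbTE iC).
Qed.
End Synthesis.

(** * Multiply controlled gates with parallel blocks, and fan-out *)

Section Macros.
Local Open Scope group_scope.
Variable n : nat.
Implicit Types (x y u : bitvec n) (i j t a k : 'I_n) (A B C X Y D W : seq 'I_n).
Implicit Types (s p q r m : {perm bitvec n}).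
Let I := enum 'I_n.

Lemma sub_enum X : {subset X <= I}.
Proof. by move=> k _; rewrite mem_enum. Qed.

(** This is [blocks] with no controls to distribute: every block is empty, its conjunction is true,
    and each line of [C] is flipped. *)
Lemma not_layer C : uniq C -> exists2 q, realizable C 1 q &
  forall x k, q x k = if k \in C then ~~ x k else x k.
Proof.
move=> UC; have [||//|q [S [rq S0 _ qE]]] := @blocks n 0 C [::] [::].
- by rewrite !cats0.
- by [].
exists q; first by move: rq; rewrite !cats0.
move=> x k; rewrite qE; case: ifP => // _.
have -> : S k = [::] by case: (S k) (S0 k) => // a l /(_ a (mem_head _ _)).
by rewrite addbT.
Qed.

(* After [w], line [i] of [C] carries [x_i + 1 + AND(S_i)], which is [AND(S_i)]
   as soon as [x_i = 1]: the controls in [C], once known to be on, serve as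
   clean workspace. *)
Lemma mcx_split (c : nat) t a C A B : uniq (t :: a :: C ++ A ++ B) ->
  size C < size B -> size A <= size B -> size A <= c * size C ->
  realizable I (16 * c + 16 * size C + 20) (tof (C ++ A) t).
Proof.
move=> U sCB sAB sAC.
have [|//|//|v [S [rv SA allS vE]]] := @blocks _ c C A B.
  by move: U => /= /and3P[].
move: U; rewrite /= !inE !mem_cat !negb_or !cat_uniq has_cat negb_or -!andbA.
case/and5P => ta tC tA tB /and5P[aC aA aB UC].
case/and5P => /hasPn AC /hasPn BC UA /hasPn BA UB.
have [q rq qE] := not_layer UC.
pose w := v * q.
have wE x k : w x k = if k \in C then x k (+) ~~ all x (S k) else x k.
  by rewrite permM qE vE; case: (k \in C) => //; rewrite addbN.
have CS i k : i \in C -> k \in S i -> k \notin C by move=> _ /SA /AC.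
have rw : realizable I (4 * c + 2) w.
  have -> : 4 * c + 2 = (4 * c + 1) + 1 by clear; lia.
  apply: realizable_mul.
    by apply: realizable_mono rv => //; apply: sub_enum.
  by apply: realizable_mono rq => //; apply: sub_enum.
clearbody w.
have rladder D k : uniq (k :: D ++ B) -> size D <= size B ->
    realizable I (4 * size D + 1) (tof D k).
  move=> UD sD; apply: realizable_mono (ladder UD sD) => //; exact: sub_enum.
(* The second [w] undoes the first, because the blocks [S k] lie outside [C]; hence [r] changes [t]
   alone. *)
pose r := w * tof (a :: C) t * w.
pose f x := all (w x) C; pose h x := all x C.
have off_t x y : (forall k, k != t -> x k = y k) -> forall k, k != t -> w x k = w y k.
  move=> xy k kt; rewrite !wE xy //; case: ifP => // kC; congr (_ (+) ~~ _).
  by apply: eq_all_off xy _; apply: contra tA => /SA.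
have rE x k : r x k = if k == t then x k (+) (x a && f x) else x k.
  rewrite /r !permM; set y := w x.
  have yE l : tof (a :: C) t y l =
      if l == t then y l (+) (y a && f x) else y l.
    by rewrite tofE // inE negb_or ta.
  case: (eqVneq k t) => [->|kt].
    rewrite wE (negbTE tC) yE eqxx /y !wE (negbTE tC).
    by rewrite (negbTE aC).
  rewrite (off_t _ y) => // [|l /negbTE lt]; last by rewrite yE lt.
  rewrite wE /y; case: ifP => kC; last by rewrite wE kC.
  have -> : all (w x) (S k) = all x (S k).
    by apply: eq_in_all => l /(CS _ _ kC) /negbTE lC; rewrite wE lC.
  by rewrite wE kC -addbA addbb addbF.
have mE x k : tof C a x k = if k == a then x k (+) h x else x k.
  by rewrite tofE.
have fh x y : (forall k, k != t -> k != a -> x k = y k) -> f x = f y /\ h x = h y.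
  move=> xy; have xyX X : t \notin X -> a \notin X -> {in X, x =1 y}.
    move=> tX aX k kX; apply: xy; first by apply: contraNneq tX => <-.
    by apply: contraNneq aX => <-.
  split; apply: eq_in_all => k kC; last exact: (xyX C).
  rewrite !wE kC (xyX C) //; congr (_ (+) ~~ _); apply: eq_in_all.
  by apply: xyX; apply: contra (SA k _) _.
(* By [toggle], [t] is flipped when both AND(C) and [f] hold. Where all of [C] is on, [f] equals
   AND(A); elsewhere its value does not matter. *)
have -> : tof (C ++ A) t = r * tof C a * r * tof C a.
  apply/permP => x; apply/ffunP => k; rewrite (toggle ta rE mE fh).
  rewrite tofE ?mem_cat ?negb_or ?tC //; congr (if _ then _ (+) _ else _).
  rewrite all_cat /h /f -allS; case: (boolP (all x C)) => // /allP xC /=.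
  by apply: eq_in_all => i iC; rewrite wE iC xC // addTb negbK.
have rr : realizable I (8 * c + 4 * size C + 9) r.
  apply: (@realizable_le _ _ (4 * c + 2 + (4 * size (a :: C) + 1) + (4 * c + 2))).
    by rewrite /=; clear; lia.
  apply: realizable_mul => //; apply: realizable_mul => //; apply: rladder => //.
  rewrite /= inE mem_cat !negb_or ta tC tB mem_cat negb_or aC aB.
  rewrite cat_uniq UC UB /= andbT.
  by apply/hasPn.
have rU : realizable I (4 * size C + 1) (tof C a).
  apply: rladder; last exact: ltnW.
  rewrite /= mem_cat !negb_or aC aB cat_uniq UC UB /= andbT.
  by apply/hasPn.
apply: (@realizable_le _ _ (8 * c + 4 * size C + 9 + (4 * size C + 1) +
  (8 * c + 4 * size C + 9) + (4 * size C + 1))).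
  by clear; lia.
by do 3!apply: realizable_mul => //.
Qed.

Lemma mcx (c : nat) t D B : uniq (t :: D ++ B) ->
  c <= size D -> c.+2 <= size B -> size D <= size B + c - 1 ->
  size D <= c * c + c -> realizable I (32 * c + 20) (tof D t).
Proof.
case: B => // a B U cD cB DB Dcc.
have sC : size (take c D) = c by rewrite size_takel.
rewrite -{1}(cat_take_drop c D).
have -> : 32 * c + 20 = 16 * c + 16 * size (take c D) + 20 by rewrite sC; lia.
have P : perm_eq (t :: a :: take c D ++ drop c D ++ B) (t :: D ++ a :: B).
  by apply/seq.permP => q; rewrite -{3}(cat_take_drop c D) /= !count_cat /=; lia.
apply: (@mcx_split c t a _ _ B); rewrite ?(perm_uniq P) ?sC ?size_drop //.
- by move: DB => /=; lia.
- by lia.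
Qed.

Lemma cnot_pairs A B : uniq (A ++ B) -> size B <= size A ->
  exists q (m : 'I_n -> 'I_n), [/\ realizable (A ++ B) 1 q,
    {in B, forall k, m k \in A} &
    forall x k, q x k = if k \in B then x k (+) x (m k) else x k].
Proof.
elim: B A => [|b B IH] [|a A] //= U sBA; try by
  exists 1, id; split => //; [exact: realizable1|move=> x k; rewrite perm1].
have P : perm_eq ([:: b; a] ++ (A ++ B)) ((a :: A) ++ b :: B).
  by apply/seq.permP => q; rewrite /= !count_cat /=; lia.
have {}U : uniq ([:: b; a] ++ (A ++ B)) by rewrite (perm_uniq P).
have dis := uniq_cat_disjoint U.
have UAB : uniq (A ++ B) by move: U => /= /and3P[].
have [q [m [rq mA qE]]] := IH A UAB sBA.
move: U; rewrite /= inE !mem_cat !negb_or => /and3P[/and3P[ba bA bB] /andP[aA aB] _].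
exists (tof [:: a] b * q), (fun k => if k == b then a else m k); split.
- apply: (@realizable_mono _ ([:: b; a] ++ (A ++ B)) _ 1) => //.
    by move=> k; rewrite (perm_mem P).
  by apply: realizable_par => //; apply: realizable_tof.
- move=> k; rewrite !inE; case: eqP => /= [_ _|_ /mA ->]; first by rewrite eqxx.
  by rewrite orbT.
move=> x k; rewrite permM qE inE !tofE ?inE //.
case: (eqVneq k b) => [->|kb] /=; first by rewrite (negbTE bB) andbT.
by case: ifP => // /mA kA; case: eqP kA => // ->; rewrite (negbTE bA).
Qed.

(** Recursion by halving: each line of [B] receives its partner in [A] both before and after the
    fan-out to [A], so the partner's old value cancels and [x i] remains. Each doubling costs two
    layers and no clean line. *)
Lemma fan_out (e : nat) i W : uniq (i :: W) -> size W <= 2 ^ e ->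
  exists2 q, realizable I (2 * e + 1) q &
    forall x k, q x k = if k \in W then x k (+) x i else x k.
Proof.
elim: e W => [|e IH] W U sW.
  case: W U sW => [|w [|//]] U _.
    by exists 1; [exact: realizable1|move=> x k; rewrite perm1].
  exists (tof [:: i] w).
    have := realizable_tof w (isT : size [:: i] <= 2).
    by apply: realizable_mono => //; apply: sub_enum.
  move=> x k; rewrite tofE ?inE /= ?andbT //.
  by move: U; rewrite /= inE eq_sym; case/andP.
rewrite -(cat_take_drop (2 ^ e) W) in U *.
have := size_take (2 ^ e) W; have := size_drop (2 ^ e) W.
set A := take _ _ in U *; set B := drop _ _ in U * => sB sA.
have sAe : size A <= 2 ^ e by rewrite sA; case: ltnP.
have sBA : size B <= size A.
  rewrite sA; case: ltnP => sWe.
    by rewrite sB leq_subLR addnn -mul2n -expnS.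
  by rewrite sB; move: sWe; rewrite -subn_eq0 => /eqP ->.
move: U; rewrite /= mem_cat negb_or => /andP[/andP[iA iB] UAB].
have UA : uniq A by move: UAB; rewrite cat_uniq => /and3P[].
have AB k : k \in A -> k \notin B.
  move=> kA; move: UAB; rewrite cat_uniq => /and3P[_ /hasPn h _].
  by apply/negP => /h /=; rewrite kA.
have [q [m [rq mA qE]]] := cnot_pairs UAB sBA.
have [|//|p rp pE] := IH A; first by rewrite /= iA.
have {}rq : realizable I 1 q by apply: realizable_mono rq => //; apply: sub_enum.
exists (q * p * q).
  apply: (@realizable_le _ _ (1 + (2 * e + 1) + 1)); first by lia.
  by do 2!apply: realizable_mul => //.
move=> x k; rewrite !permM qE mem_cat.
have qi : q x i = x i by rewrite qE (negbTE iB).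
case: (boolP (k \in B)) => kB.
  have kA : k \in A = false by apply/negbTE/negP => /AB; rewrite kB.
  rewrite !pE kA qE kB mA // qi qE (negbTE (AB _ (mA _ kB))).
  by case: (x k); case: (x (m k)); case: (x i).
by rewrite orbF pE qi qE (negbTE kB).
Qed.
End Macros.

(** * Three-cycles *)

Section ThreeCycles.
Local Open Scope group_scope.
Variable T : finType.
Implicit Types (s g h : {perm T}).

(** As the supports meet only at [p], [h] fixes [g p] and [g] fixes [h p], so the product runs [p]
    to [h p] to [g p] and back. At any other point at most one of [g], [h] acts, and its two
    occurrences cancel. *)
Lemma commutator_3cycle g h (p : T) : g * g = 1 -> h * h = 1 ->
  g p != p -> h p != p -> (forall x, g x != x -> h x != x -> x = p) ->
  g * h * g * h = tperm (g p) (h p) * tperm p (h p).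
Proof.
move=> gg hh gp hp gh.
have gK x : g (g x) = x by rewrite -permM gg perm1.
have hK x : h (h x) = x by rewrite -permM hh perm1.
have gh' x : x != p -> g x != x -> h x = x.
  by move=> xp gx; apply/eqP; apply: contraNT xp => /(gh _ gx) ->.
have hg' x : x != p -> h x != x -> g x = x.
  by move=> xp hx; apply/eqP; apply: contraNT xp => gx; rewrite (gh x).
have hgp : h (g p) = g p by apply: gh' => //; rewrite gK eq_sym.
have ghp : g (h p) = h p by apply: hg' => //; rewrite hK eq_sym.
have gphp : g p != h p.
  by apply/eqP => e; move: gp; rewrite -[X in _ != X]gK e ghp eqxx.
apply/permP => x; rewrite !permM.
case: (eqVneq x p) => [->|xp].
  by rewrite (tpermD gp hp) tpermL hgp gK.
case: (eqVneq x (g p)) => [->|xgp].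
  by rewrite tpermL tpermR gK ghp hK.
case: (eqVneq x (h p)) => [->|xhp].
  by rewrite tpermR (tpermD _ _) 1?eq_sym // ghp hK.
rewrite !tpermD ?[_ == x]eq_sym //.
have gxp : g x != p by apply: contraNneq xgp => <-; rewrite gK.
have hxp : h x != p by apply: contraNneq xhp => <-; rewrite hK.
case: (eqVneq (g x) x) => [gx|gx].
  rewrite gx; case: (eqVneq (h x) x) => [hx|hx]; first by rewrite !(hx, gx).
  by rewrite (hg' (h x)) // hK eq_sym.
by rewrite (gh' (g x)) ?gK ?(gh' x) // eq_sym.
Qed.

(** Induction on the number of moved points. For a moved [x] and [y = s x], evenness provides a
    third moved point [z], since otherwise [s] would be the transposition of [x] and [y]. A 3-cycle
    [tau] on these points with [tau y = x] makes [tau * s] fix [y], and it moves no point that [s]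
    fixes. *)
Lemma even_perm_3cycles s : ~~ odd_perm s ->
  exists cs : seq (T * T * T),
    [/\ size cs <= #|[set x | s x != x]|,
        all (fun c => uniq [:: c.1.1; c.1.2; c.2]) cs &
        s = \prod_(c <- cs) (tperm c.1.2 c.2 * tperm c.1.1 c.2)].
Proof.
move: {2}#|_| (leqnn #|[set x | s x != x]|) => N; elim: N s => [|N IH] s sN even_s.
  exists [::]; split => //; rewrite big_nil; apply/permP => x; rewrite perm1.
  move: sN; rewrite leqn0 cards_eq0 => /eqP/setP/(_ x).
  by rewrite finset.in_set finset.in_set0 => /negbFE/eqP.
have [s1|[x sx]] : s = 1 \/ exists x, s x != x.
  case: (pickP (fun x => s x != x)) => [x sx|s1]; [right|left]; first by exists x.
  by apply/permP => x; rewrite perm1; apply/eqP/negbFE/s1.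
  by exists [::]; split => //; rewrite big_nil.
pose y := s x; have xy : x != y by rewrite eq_sym.
have sy : s y != y by rewrite (inj_eq perm_inj).
have [z [zx zy sz]] : exists z, [/\ z != x, z != y & s z != z].
  case: (pickP (fun z => [&& z != x, z != y & s z != z])) => [z /and3P[]|no].
    by exists z.
  have fix_s z : z != x -> z != y -> s z = z.
    by move=> zx zy; have := no z; rewrite zx zy => /negbFE/eqP.
  have syx : s y = x.
    apply/eqP/negPn/negP => syx; move: (fix_s _ syx sy) => /perm_inj e.
    by rewrite e eqxx in sy.
  suff es : s = tperm x y by move: even_s; rewrite es odd_tperm xy.
  apply/permP => w; case: tpermP => [->|->|/eqP wx /eqP wy] //; exact: fix_s.
pose tau := tperm z x * tperm y x; pose s' := tau * s.
have tau_y : tau y = x by rewrite permM (@tpermD _ z x y) // tpermL.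
have fix_s' w : s w = w -> s' w = w.
  move=> sw; have off v : s v != v -> v != w by apply: contraNneq => ->; rewrite sw.
  by rewrite !permM !tpermD ?off.
have s'y : s' y = y by rewrite permM tau_y.
have lt_s' : #|[set w | s' w != w]| < #|[set w | s w != w]|.
  apply: proper_card; apply/properP; split.
    apply/fintype.subsetP => w; rewrite !finset.in_set; apply: contra => /eqP sw.
    by rewrite fix_s'.
  by exists y; rewrite finset.in_set ?sy // s'y eqxx.
have [|/=|cs [scs ucs s'E]] := IH s'; first by rewrite -ltnS (leq_trans lt_s').
  by rewrite !odd_permM !odd_tperm zx eq_sym xy.
exists ((z, y, x) :: cs); split; first exact: leq_ltn_trans lt_s'.
  by rewrite /= ucs !inE negb_or zx zy eq_sym xy.
rewrite big_cons -s'E /s' /tau /= -!mulgA (mulgA (tperm z x)) tperm2 mul1g.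
by rewrite mulgA tperm2 mul1g.
Qed.
End ThreeCycles.

(** * Depth of 3-cycles of Z_2^n and the resulting bound on [D0] *)

Section CycleDepth.
Local Open Scope group_scope.
Variable n : nat.
Implicit Types (x y u v a b d : bitvec n) (i j k : 'I_n) (A B C X Y D W : seq 'I_n).
Implicit Types (s p q r m : {perm bitvec n}).
Let I := enum 'I_n.

Definition ones : bitvec n := [ffun=> true].
Definition ones_but i : bitvec n := [ffun k => k != i].

Lemma canonical_3cycle (c : nat) i j : i != j -> 3 <= c -> c + 3 <= n./2 ->
  n <= c * c ->
  realizable I (4 * (32 * c + 20))
    (tperm (ones_but i) (ones_but j) * tperm ones (ones_but j)).
Proof.
move=> ij c3 cn ncc.
pose L := [seq k <- I | (k != i) && (k != j)].
have PL : perm_eq (i :: j :: L) I.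
  apply: uniq_perm; rewrite ?enum_uniq //=.
    rewrite inE negb_or ij !mem_filter !eqxx /= andbF /=.
    by rewrite filter_uniq ?enum_uniq.
  move=> k; rewrite !inE mem_filter mem_enum andbT.
  by case: eqP => //=; case: eqP.
have sL : (size L).+2 = n by rewrite -[in RHS](size_enum_ord n) -(perm_size PL).
pose A := take (n./2).-1 L; pose B := drop (n./2).-1 L.
have n2 : n./2 + uphalf n = n by rewrite uphalfE -[n in RHS]odd_double_half; lia.
have n2' : uphalf n <= n./2 + 1 by rewrite uphalf_half; case: (odd n); lia.
have sA : size A = (n./2).-1 by rewrite size_takel //; lia.
have sB : size B = uphalf n - 1 by rewrite size_drop; lia.
have cover k : k \in i :: j :: A ++ B by rewrite cat_take_drop (perm_mem PL) mem_enum.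
have U : uniq (i :: j :: A ++ B) by rewrite cat_take_drop (perm_uniq PL) enum_uniq.
have U1 : uniq (i :: (j :: A) ++ B) by [].
have U2 : uniq (j :: (i :: B) ++ A).
  suff /perm_uniq -> : perm_eq (j :: (i :: B) ++ A) (i :: j :: A ++ B) by [].
  by apply/seq.permP => q; rewrite /= !count_cat; lia.
have rg : realizable I (32 * c + 20) (tof (j :: A) i).
  by apply: mcx U1 _ _ _ _; rewrite /= ?sA ?sB; clear -c3 cn ncc n2 n2'; lia.
have rh : realizable I (32 * c + 20) (tof (i :: B) j).
  by apply: mcx U2 _ _ _ _; rewrite /= ?sA ?sB; clear -c3 cn ncc n2 n2'; lia.
have iD : i \notin j :: A.
  by move: U1; rewrite /= !inE mem_cat !negb_or => /and3P[/and3P[-> ->]].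
have jD : j \notin i :: B.
  by move: U2; rewrite /= !inE mem_cat !negb_or => /and3P[/and3P[-> ->]].
have gE x k : tof (j :: A) i x k = if k == i then x k (+) all x (j :: A) else x k.
  exact: tofE.
have hE x k : tof (i :: B) j x k = if k == j then x k (+) all x (i :: B) else x k.
  exact: tofE.
have all1 X : all ones X by apply/allP => k _; rewrite ffunE.
have g1 : tof (j :: A) i ones = ones_but i.
  by apply/ffunP => k; rewrite gE all1 !ffunE; case: eqP.
have h1 : tof (i :: B) j ones = ones_but j.
  by apply/ffunP => k; rewrite hE all1 !ffunE; case: eqP.
have neq1 k : ones_but k != ones.
  by apply/eqP => /ffunP/(_ k); rewrite !ffunE eqxx.
rewrite -g1 -h1 -commutator_3cycle ?tof_sq ?g1 ?h1 //.
  apply: (@realizable_le _ _ (32 * c + 20 + (32 * c + 20) +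
    (32 * c + 20) + (32 * c + 20))).
    by clear; lia.
  by do 3!apply: realizable_mul => //.
(* A point moved by both gates has all controls of both on, and together these controls cover every
   line. *)
move=> x gx hx.
have /allP xA : all x (j :: A).
  apply: contraNT gx => /negbTE xA; apply/eqP/ffunP => k; rewrite gE xA addbF.
  by case: ifP.
have /allP xB : all x (i :: B).
  apply: contraNT hx => /negbTE xB; apply/eqP/ffunP => k; rewrite hE xB addbF.
  by case: ifP.
apply/ffunP => k; rewrite ffunE; have := cover k.
rewrite !inE mem_cat => /or4P[ki|kj|kA|kB]; apply/idP.
- by apply: xB; rewrite inE ki.
- by apply: xA; rewrite inE kj.
- by apply: xA; rewrite inE kA orbT.
- by apply: xB; rewrite inE kB orbT.
Qed.

Lemma xor_layer u : exists2 q, realizable I 1 q &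
  forall x k, q x k = x k (+) u k.
Proof.
have [|q rq qE] := @not_layer n [seq k <- I | u k].
  by rewrite filter_uniq ?enum_uniq.
exists q; first by apply: realizable_mono rq => //; apply: sub_enum.
by move=> x k; rewrite qE mem_filter mem_enum andbT; case: (u k); rewrite ?addbT ?addbF.
Qed.

Lemma fan_layer (e : nat) u i : n <= 2 ^ e ->
  exists2 q, realizable I (2 * e + 1) q &
    forall x k, q x k = x k (+) [&& x i, k != i & u k].
Proof.
move=> ne; pose W := [seq k <- I | (k != i) && u k].
have [||q rq qE] := @fan_out n e i W.
- by rewrite /= mem_filter eqxx filter_uniq ?enum_uniq.
- apply: leq_trans ne.
  by rewrite size_filter (leq_trans (count_size _ _)) // size_enum_ord.
exists q => // x k; rewrite qE mem_filter mem_enum andbT.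
by case: ifP => _; rewrite ?andbT ?andbF ?addbF.
Qed.

(** Adding [a] sends [a] to 0; a fan-out from a line [i] where [a] and [b] differ sends [b] to e_i.
    The image [v] of [d] is neither 0 nor e_i, so it is on at some [j != i]; a fan-out from [j]
    reduces it to e_j and fixes 0 and e_i, where [j] is off. Finally all lines are complemented. *)
Lemma straighten (e : nat) a b d : n <= 2 ^ e -> uniq [:: a; b; d] ->
  exists q i j, [/\ i != j, realizable I (4 * e + 4) q, q a = ones,
    q b = ones_but i & q d = ones_but j].
Proof.
move=> ne; rewrite /= !inE negb_or andbT => /andP[/andP[ab ad] bd].
have [i abi] : exists i, a i != b i.
  apply/existsP; rewrite -negb_forall; apply: contra ab => /forallP e_.
  by apply/eqP/ffunP => k; apply/eqP.
have [q1 rq1 q1E] := xor_layer a.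
have [q2 rq2 q2E] := @fan_layer e [ffun k => a k (+) b k] i ne.
pose v := q2 (q1 d).
have q12b k : q2 (q1 b) k = (k == i).
  rewrite q2E !q1E ffunE; case: eqP => [->|_] /=.
    by move: abi; case: (a i); case: (b i).
  by move: abi; case: (a i); case: (b i) => //; case: (a k); case: (b k).
have q12a k : q2 (q1 a) k = false by rewrite q2E !q1E !addbb.
have [j ji vj] : exists2 j, j != i & v j.
  case: (pickP (fun j => (j != i) && v j)) => [j /andP[]|nv]; first by exists j.
  have v0 k : k != i -> v k = false by move=> ki; have := nv k; rewrite ki.
  case vi : (v i).
    case/eqP: bd; apply: (@perm_inj _ q1); apply: (@perm_inj _ q2).
    by apply/ffunP => k; rewrite q12b -/v; case: eqP => [->//|/eqP /v0].
  case/eqP: ad; apply: (@perm_inj _ q1); apply: (@perm_inj _ q2).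
  by apply/ffunP => k; rewrite q12a -/v; case: (eqVneq k i) => [->//|/v0].
have [q3 rq3 q3E] := @fan_layer e v j ne.
have [q4 rq4 q4E] := xor_layer ones.
exists (q1 * q2 * q3 * q4), i, j; split.
- by rewrite eq_sym.
- apply: (@realizable_le _ _ (1 + (2 * e + 1) + (2 * e + 1) + 1)).
    by clear; lia.
  by do 3!apply: realizable_mul => //.
- by apply/ffunP => k; rewrite !permM q4E q3E !q12a !ffunE.
- apply/ffunP => k; rewrite !permM q4E q3E !q12b (negbTE ji) !ffunE addbF.
  by rewrite addbT.
apply/ffunP => k; rewrite !permM q4E q3E -/v vj !ffunE addbT /=.
by case: eqP => [->|_]; rewrite ?vj //= addbb.
Qed.

Lemma realizable_3cycle (c e : nat) a b d : 3 <= c -> c + 3 <= n./2 ->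
  n <= c * c -> n <= 2 ^ e -> uniq [:: a; b; d] ->
  realizable I (128 * c + 8 * e + 88) (tperm b d * tperm a d).
Proof.
move=> c3 cn ncc ne abd; have [q [i [j [ij rq qa qb qd]]]] := straighten ne abd.
have -> : tperm b d * tperm a d =
    q * (tperm (ones_but i) (ones_but j) * tperm ones (ones_but j)) * q^-1.
  rewrite -qa -qb -qd -!tpermJ -conjMg.
  by rewrite /conjg !mulgA mulgV mul1g mulgK.
apply: (@realizable_le _ _ (4 * e + 4 + 4 * (32 * c + 20) + (4 * e + 4))).
  by clear; lia.
apply: realizable_mul; last exact: realizable_inv.
by apply: realizable_mul => //; apply: canonical_3cycle.
Qed.

(** The gate touches at most three lines, so some line [k] is idle; using [k] as the dirty line of
    [tof_toggle] writes the gate as a product in which each factor occurs twice. *)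
Lemma gate_perm_even (g : gate n) : 4 <= n -> Omega2 g ->
  odd_perm (gate_perm g) = false.
Proof.
move=> n4 g2; have [k kg] : exists k, k \notin lines g.
  apply/existsP; rewrite -negb_forall; apply/negP => /forallP all_g.
  suff : n <= 3 by lia.
  rewrite -[X in X <= _]card_ord -cardsT (_ : [set: _] = lines g); last first.
    by apply/setP => k; rewrite all_g finset.in_setT.
  by rewrite cardsU1; apply: leq_add (leq_b1 _) g2.
move: kg; rewrite !inE negb_or => /andP[kt kc].
have tc := target_notin_controls g.
have -> : gate_perm g = tof (enum (controls g)) (target g).
  apply/permP => x; apply/ffunP => l; rewrite tofE ?mem_enum // permE ffunE.
  case: eqP => // _; congr (_ (+) _).
  by apply/forall_inP/allP => h i; have := h i; rewrite mem_enum.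
rewrite -[enum _]cats0 -(@tof_toggle _ _ k) ?cats0 ?mem_enum //; last first.
  by rewrite /= inE eq_sym kt.
by rewrite !odd_permM; do 2!case: (odd_perm _).
Qed.

Lemma circuit_perm_even (S : circuit n) : 4 <= n -> all (@Omega2 n) S ->
  ~~ odd_perm (circuit_perm S).
Proof.
move=> n4; rewrite /circuit_perm; elim: S => [|g S IH] /=.
  by rewrite big_nil odd_perm1.
by case/andP => g2 /IH; rewrite big_cons odd_permM gate_perm_even.
Qed.

(** The output permutation [pi] is kept as it is; only the even permutation [circuit_perm S] is
    synthesized anew, from at most [2 ^ n] 3-cycles. *)
Lemma D0_le (c e : nat) : 3 <= c -> c + 3 <= n./2 -> n <= c * c -> n <= 2 ^ e ->
  D0 n <= 2 ^ n * (128 * c + 8 * e + 88).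
Proof.
move=> c3 cn ncc ne; set K := 128 * c + _ + _.
have n4 : 4 <= n by lia.
apply/bigmax_leqP => f /asboolP[S [S2 [pi fE]]].
have [cs [scs ucs SE]] := even_perm_3cycles (circuit_perm_even n4 S2).
have rS : realizable I (size cs * K) (circuit_perm S).
  rewrite {}SE {scs}; elim: cs ucs => [_|[[a b] d] cs IH] /=.
    by rewrite big_nil; apply: realizable1.
  case/andP=> abd ucs; rewrite big_cons mulSn; apply: realizable_mul; last exact: IH.
  exact: realizable_3cycle.
have [S' [l l_le [S'2 S'S S'l]]] := realizable_circuit rS.
have depth_S' : depth S' <= l.
  by apply: (minimumP _).2 => //; exists l.
have S'f : implements S' f.
  by exists pi => x; rewrite fE !circuit_permE S'S.
apply: (@leq_trans (depth S')).
  by apply: (minimumP _).2; [exists (depth S'), S'|exists S'].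
apply: leq_trans depth_S' _; apply: leq_trans l_le _.
rewrite leq_mul2r; apply/orP; right.
apply: leq_trans scs _; apply: leq_trans (max_card _) _.
by rewrite card_ffun card_bool card_ord.
Qed.
End CycleDepth.

(** * The asymptotic bound *)

Lemma linear_le_exp2 h : 9 <= h -> (33 * h <= 2 ^ h) && (16 * h + 88 <= 2 ^ h).
Proof.
elim: h => // h IH; rewrite leq_eqVlt => /orP[/eqP<- //|/IH/andP[h1 h2]].
by rewrite expnS; apply/andP; lia.
Qed.

Lemma D0_trunc_log n : 2 ^ 17 <= n ->
  D0 n * (trunc_log 2 n).+1 <= n * 2 ^ (n + 5).
Proof.
move=> n17; have n_gt0 : 0 < n by apply: leq_trans n17; rewrite expn_gt0.
(* With this [h], [c = 2 ^ h] approximates the square root of [n] from above: [n <= c * c <= 4 * n].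
   The threshold [2 ^ 17] ensures [9 <= h]. *)
set k := trunc_log 2 n; pose h := uphalf k.+1.
have nk : n < 2 ^ k.+1 by apply: trunc_log_ltn.
have kn : 2 ^ k <= n by apply: trunc_logP.
have k17 : 17 <= k by apply: trunc_log_max.
have [hk kh] : k.+1 <= h + h /\ h + h <= k.+2.
  have := odd_double_half k.+1; rewrite /h uphalf_half -addnn.
  by case: (odd k.+1) => /=; move: (k.+1)./2 => m; lia.
have h9 : 9 <= h by lia.
have /andP[h1 h2] := linear_le_exp2 h9.
set c := 2 ^ h in h1 h2.
have ccE : c * c = 2 ^ (h + h) by rewrite expnD.
have ncc : n <= c * c by rewrite ccE (leq_trans (ltnW nk)) // leq_exp2l.
have ccn : c * c <= 4 * n.
  by rewrite ccE (@leq_trans (2 ^ k.+2)) ?leq_exp2l // !expnS mulnA leq_mul2l.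
(* 297 is 33 * 9; then [297 * c <= c * c <= 4 * n] puts [c] far below [n./2]. *)
have c297 : 297 <= c by apply: leq_trans h1; rewrite (@leq_mul2l 33 9).
have cn : c + 3 <= n./2.
  rewrite -divn2 leq_divRL //; have : 297 * c <= c * c by rewrite leq_mul2r c297 orbT.
  by lia.
apply: (@leq_trans (2 ^ n * (128 * c + 8 * k.+1 + 88) * k.+1)).
  rewrite leq_mul2r; apply/orP; right; apply: D0_le => //; last exact: ltnW.
  exact: leq_trans c297.
rewrite expnD mulnCA -mulnA leq_mul2l; apply/orP; right.
(* The terms [8 * k.+1 + 88 <= 16 * h + 88] are absorbed into one more [c]. Then
   [33 * h * c <= c * c <= 4 * n] bounds 258 h c by (258 * 4 / 33) n < 32 n, which is the factor
   [2 ^ 5]. *)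
apply: (@leq_trans ((129 * c) * (h + h))).
  by apply: leq_mul => //; lia.
have : 33 * h * c <= c * c by rewrite leq_mul2r h1 orbT.
rewrite (_ : 129 * c * (h + h) = 258 * (h * c)); last by lia.
by rewrite -mulnA; move: (h * c) ccn => m; lia.
Qed.

Local Open Scope classical_set_scope.
Local Open Scope ring_scope.

Theorem theorem5 (R : realType) (phi : nat -> R)
  (phi_gt0 : forall n : nat, (1 <= n)%N -> 0 < phi n)
  (phi_cvg : phi n @[n --> \oo] --> +oo)
  (phi_lt : forall n : nat, (2 <= n)%N -> phi n < n%:R / log2 n%:R) :
  exists2 delta : nat -> R, delta n @[n --> \oo] --> (0 : R) &
    \forall n \near \oo,
      let eps := 1 / (4 * phi n)
        + (4 - delta n) * (log2 n%:R * log2 (log2 n%:R) / n%:R) in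
      (D0 n)%:R <=
        n%:R * 2 ^+ (n + 5)
          / (log2 n%:R - log2 (log2 n%:R) - log2 (phi n)) * (1 + eps).
Proof.
exists (fun=> 0); first exact: cvg_cst.
have phi1 : \forall n \near \oo, 1 <= phi n.
  by move/cvgryPge: phi_cvg; apply.
near=> n; set eps := 1 / _ + _.
have n17 : (2 ^ 17 <= n)%N by near: n; exact: nbhs_infty_ge.
have n2 : (2 <= n)%N by apply: leq_trans n17; rewrite (@leq_exp2l 2 1).
have phin : 1 <= phi n by near: n.
have n_gt0 : 0 < n%:R :> R by rewrite ltr0n; apply: leq_trans n2.
have ln2 : 0 < ln 2 :> R by rewrite ln_gt0 // ltr1n.
have log2_le (x y : R) : 0 < x -> x <= y -> log2 x <= log2 y.
  move=> x0 xy; rewrite /log2 ler_pM2r ?invr_gt0 // ler_ln // posrE //.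
  exact: lt_le_trans xy.
have log2_ge0 (x : R) : 1 <= x -> 0 <= log2 x.
  by move=> x1; apply: divr_ge0; [exact: ln_ge0|exact: ltW].
have log2_2X m : log2 (2 ^+ m) = m%:R :> R.
  by rewrite /log2 lnXn // mulrnAl divff ?gt_eqF.
have log2n : 1 <= log2 n%:R :> R.
  by rewrite -[leLHS](log2_2X 1%N) expr1 log2_le // ler_nat.
set L := log2 n%:R - _ - _.
have log2n_gt0 : 0 < log2 n%:R :> R by apply: lt_le_trans log2n.
have phi_gt0n : 0 < phi n by apply: lt_le_trans phin.
(* Positivity of the denominator is the hypothesis [phi n < n / log2 n] after taking logarithms. *)
have L_gt0 : 0 < L.
  rewrite /L subr_gt0 /log2 -mulrBl ltr_pM2r ?invr_gt0 // -/(log2 _).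
  have q_gt0 : 0 < n%:R / log2 n%:R :> R by apply: divr_gt0.
  rewrite -ln_div ?posrE // ltr_ln ?posrE //.
  exact: phi_lt.
(* Both subtracted logarithms are nonnegative, as [log2 n] and [phi n] are at least 1. *)
have LK : L <= (trunc_log 2 n).+1%:R.
  apply: (@le_trans _ _ (log2 n%:R)).
    by rewrite /L -addrA -opprD gerBl; apply: addr_ge0; apply: log2_ge0.
  rewrite -[leRHS]log2_2X log2_le // -natrX ler_nat ltnW //.
  exact: trunc_log_ltn.
have eps_ge0 : 0 <= eps.
  rewrite /eps subr0; apply: addr_ge0.
    by apply: divr_ge0 => //; apply: mulr_ge0 => //; apply: ltW.
  apply: mulr_ge0 => //; apply: divr_ge0; last exact: ltW.
  by apply: mulr_ge0; [apply: ltW|apply: log2_ge0].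
apply: (@le_trans _ _ (n%:R * 2 ^+ (n + 5) / L)); last first.
  apply: ler_peMr; last by rewrite lerDl.
  by apply: divr_ge0; rewrite ?mulr_ge0 ?exprn_ge0 ?ltW.
rewrite ler_pdivlMr //; apply: (@le_trans _ _ ((D0 n)%:R * (trunc_log 2 n).+1%:R)).
  by rewrite ler_wpM2l.
by rewrite -natrX -!natrM ler_nat D0_trunc_log.
Unshelve. all: by end_near.
Qed.
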